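(* If $T^\nu_Z$ is an invertible operator for a closed subspace $Z\subset X$ and there are constants $\lambda,M>0$ such that $$\|\mathcal A_{m,n}x\|_m\le M\left(\frac{\log(m+2)}{\log(n+2)}\right)^\lambda\|x\|_n$$ for all $m\ge n$ and $x\in X$, then $(A_m)_{m\in\mathbb N}$ admits a nonuniform logarithmic dichotomy with respect to the sequence of norms $(\|\cdot\|_m)_{m\in\mathbb N}$.
   Context: $\mathbb N=\{1,2,\dots\}$ and $\nu=(\nu_n)_{n\in\mathbb N}$ is the sequence $\nu_n=\log(n+1)$ (natural logarithm). $(X,\|\cdot\|)$ is a Banach space and $(A_n)_{n\in\mathbb N}$ is a sequence of bounded linear operators on $X$. For $m\ge n$, $\mathcal A_{m,n}=A_{m-1}\cdots A_n$ if $m>n$ and $\mathcal A_{m,n}=\mathrm{Id}$ if $m=n$. $(\|\cdot\|_m)_{m\in\mathbb N}$ is a sequence of norms on $X$ such that each $\|\cdot\|_m$ is equivalent to $\|\cdot\|$. $(A_m)$ admits a nonuniform logarithmic dichotomy with respect to $(\|\cdot\|_m)$ if there are projections $P_m$, $m\in\mathbb N$, on $X$ such that $A_m|_{\ker P_m}:\ker P_m\to\ker P_{m+1}$ is invertible for all $m$, $P_m\mathcal A_{m,n}=\mathcal A_{m,n}P_n$ for $m\ge n$, and there are constants $\lambda,D>0$ such that for all $x\in X$ and $m,n\in\mathbb N$: $\|\mathcal A_{m,n}P_nx\|_m\le D(\nu_m/\nu_n)^{-\lambda}\|x\|_n$ for $m\ge n$, and $\|\mathcal A_{m,n}Q_nx\|_m\le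 D(\nu_n/\nu_m)^{-\lambda}\|x\|_n$ for $m\le n$, where $Q_n=\mathrm{Id}-P_n$ and, for $m\le n$, $\mathcal A_{m,n}=(\mathcal A_{n,m})^{-1}:\ker P_n\to\ker P_m$. For a sequence $x=(x_m)_{m\in\mathbb N}$ in $X$ put $\|x\|_\infty=\sup_m\|x_m\|_m$; $Y$ is the space of sequences with $\|x\|_\infty<\infty$; for a subspace $Z\subset X$, $Y_Z=\{x\in Y:x_1\in Z\}$, and $Y_0=Y_{\{0\}}$. The linear operator $T^\nu_Z:\mathcal D(T^\nu_Z)\to Y_0$ is given by $(T^\nu_Zx)_1=0$ and $(T^\nu_Zx)_m=\dfrac{\log(m+1)}{\log(1+1/(m+1))}(x_m-A_{m-1}x_{m-1})$ for $m\ge2$, with domain $\mathcal D(T^\nu_Z)=\{x\in Y_Z:T^\nu_Zx\in Y_0\}$ endowed with the norm $\|x\|_{T^\nu_Z}=\|x\|_\infty+\|T^\nu_Zx\|_\infty$. $Y_0$ carries $\|\cdot\|_\infty$. Invertible means bijective with bounded inverse. *)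

(* Defs.v *)
From HB Require Import structures.
From mathcomp Require Import all_boot all_order all_algebra.
From mathcomp Require Import complex.
From mathcomp Require Import all_classical all_reals all_analysis.
Set Implicit Arguments.
Unset Strict Implicit.
Unset Printing Implicit Defensive.
Import Order.TTheory GRing.Theory Num.Theory.
Import numFieldNormedType.Exports.
Local Open Scope classical_set_scope.
Local Open Scope ring_scope.

(* A Banach space is allowed to be real or complex: its field of scalars is
   [scalar_field R s], i.e. R or R[i]. All norms are R-valued; in particular
   [vnorm] reads the library norm (which has values in the field of scalars)
   as an element of R. *)
Variant scalars := RealScalars | ComplexScalars.

Definition scalar_field (R : realType) (s : scalars) : numFieldType :=
  match s with RealScalars => R | ComplexScalars => R[i]%C end.

Definition modulus (R : realType) (s : scalars) : scalar_field R s -> R :=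
  match s return scalar_field R s -> R with
  | RealScalars => fun k : R => `|k|
  | ComplexScalars => fun k : R[i]%C => complex.Re `|k|
  end.

Definition of_real (R : realType) (s : scalars) : R -> scalar_field R s :=
  match s return R -> scalar_field R s with
  | RealScalars => fun r => r
  | ComplexScalars => fun r => real_complex R r
  end.

Definition vnorm (R : realType) (s : scalars)
    (X : normedModType (scalar_field R s)) (x : X) : R := modulus `|x|.

Definition is_norm (R : realType) (s : scalars)
    (X : lmodType (scalar_field R s)) (N : X -> R) : Prop :=
  [/\ forall x, 0 <= N x,
      forall x, N x = 0 -> x = 0,
      forall (k : scalar_field R s) x, N (k *: x) = modulus k * N x
    & forall x y, N (x + y) <= N x + N y].

Definition equivalent_norms (R : realType) (T : Type) (N N' : T -> R) : Prop :=
  exists c C : R, [/\ 0 < c, 0 < C & forall x, c * N' x <= N x <= C * N' x].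

Definition bounded_operator (R : realType) (s : scalars)
    (X : normedModType (scalar_field R s)) (f : X -> X) : Prop :=
  exists C : R, forall x, vnorm (f x) <= C * vnorm x.

(* [f] restricted to [U] is a bijection onto [V] whose inverse is bounded. *)
Definition invertible_between (R : realType) (E F : zmodType)
    (U : set E) (V : set F) (normU : E -> R) (normV : F -> R) (f : E -> F) :
    Prop :=
  set_bij U V f /\
  exists C : R, forall y, V y -> normU ('pinv_(fun=> 0) U f y) <= C * normV y.

(* [nu n] and [weight n] take the index n >= 1 of the text. Sequences indexed
   by {1, 2, ...} are functions on [nat] whose value at k is the term of index
   k.+1; so the term x_(k.+1) is [x k], A_(k.+1) is [A k], the norm of index
   k.+1 is [N k], and nu_(k.+1) is [nu k.+1]. *)
Definition nu (R : realType) (n : nat) : R := ln (n.+1)%:R.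

Definition weight (R : realType) (n : nat) : R :=
  ln (n.+1)%:R / ln (1 + (n.+1)%:R^-1).

(* A_(m-1) ... A_n for m > n, and the identity for m = n; only used when
   n <= m. *)
Fixpoint evol (X : Type) (A : nat -> X -> X) (m n : nat) (x : X) : X :=
  if m is p.+1 then if (n <= p)%N then A p (evol A p n x) else x else x.

Definition ker (X : Type) (Y : zmodType) (f : X -> Y) : set X :=
  [set x | f x = 0].

(* For m <= n, 'pinv_(fun=> 0) (ker (P m)) (evol A n m) is the inverse of
   A_(n,m) : ker P_m -> ker P_n. Boundedness of P_n is not required separately:
   it follows from the first estimate with m = n. *)
Definition nonuniform_log_dichotomy (R : realType) (s : scalars)
    (X : normedModType (scalar_field R s))
    (A : nat -> {linear X -> X}) (N : nat -> X -> R) : Prop :=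
  exists P : nat -> {linear X -> X},
  [/\ forall m x, P m (P m x) = P m x,
      forall m, invertible_between (ker (P m)) (ker (P m.+1))
                  (@vnorm R s X) (@vnorm R s X) (A m),
      forall m n x, (n <= m)%N -> P m (evol A m n x) = evol A m n (P n x)
    & exists lambda D : R,
      [/\ 0 < lambda, 0 < D,
          forall m n x, (n <= m)%N ->
            N m (evol A m n (P n x))
            <= D * (nu R m.+1 / nu R n.+1) `^ (- lambda) * N n x
        & forall m n x, (m <= n)%N ->
            N m ('pinv_(fun=> 0) (ker (P m)) (evol A n m) (x - P n x))
            <= D * (nu R n.+1 / nu R m.+1) `^ (- lambda) * N n x]].

Definition supnorm (R : realType) (X : Type) (N : nat -> X -> R)
    (x : nat -> X) : R := sup (range (fun m => N m (x m))).

(* The supremum [supnorm N x] is finite exactly when the set of the N m (x m)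
   is bounded above; only then does [sup] carry its meaning. *)
Definition Y_ (R : realType) (X : Type) (N : nat -> X -> R) (Z : set X) :
    set (nat -> X) :=
  [set x | has_ubound (range (fun m => N m (x m))) /\ Z (x 0%N)].

(* At k.+1, i.e. at the index m = k.+2 of the text, this is
   (log (m+1) / log (1 + 1/(m+1))) (x_m - A_(m-1) x_(m-1)). *)
Definition T_nu (R : realType) (s : scalars)
    (X : lmodType (scalar_field R s)) (A : nat -> X -> X)
    (x : nat -> X) (m : nat) : X :=
  if m is k.+1 then of_real s (weight R k.+2) *: (x k.+1 - A k (x k)) else 0.

Definition T_dom (R : realType) (s : scalars)
    (X : lmodType (scalar_field R s)) (A : nat -> X -> X) (N : nat -> X -> R)
    (Z : set X) : set (nat -> X) :=
  [set x | Y_ N Z x /\ Y_ N [set 0] (T_nu A x)].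

Definition graph_norm (R : realType) (s : scalars)
    (X : lmodType (scalar_field R s)) (A : nat -> X -> X) (N : nat -> X -> R)
    (x : nat -> X) : R := supnorm N x + supnorm N (T_nu A x).

Definition T_nu_invertible (R : realType) (s : scalars)
    (X : lmodType (scalar_field R s)) (A : nat -> X -> X) (N : nat -> X -> R)
    (Z : set X) : Prop :=
  invertible_between (T_dom A N Z) (Y_ N [set 0])
    (graph_norm A N) (supnorm N) (T_nu A).

(* Main.v *)
Require Import Defs.
From HB Require Import structures.
From mathcomp Require Import all_boot all_order all_algebra.
From mathcomp Require Import complex.
From mathcomp Require Import all_classical all_reals all_analysis.
From mathcomp Require Import ring lra zify.
Set Implicit Arguments.
Unset Strict Implicit.
Unset Printing Implicit Defensive.
Import Order.TTheory GRing.Theory Num.Theory.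
Import numFieldNormedType.Exports.
Local Open Scope classical_set_scope.
Local Open Scope ring_scope.

(** The weights of the operator are those of a change of time.  Put
[t_m = sum_(j < m) 1 / weight (j + 2)].  Then
[t_(m+1) - t_m = nu (m + 3) / nu (m + 2) - 1], so that [t] has steps in
[[0, 1]], is unbounded (it grows like log log m), and satisfies
[nu (m + 2) / nu (n + 2) <= exp (t_m - t_n)].  In the time [t] the hypothesis
on [A] is exponential growth, a logarithmic dichotomy is an exponential one,
and invertibility of the operator says that the equation
[x_(j+1) = A_j x_j + (t_(j+1) - t_j) y_j] has, for each bounded [y], exactly
one bounded solution with [x_0] in [Z], which depends boundedly on [y].  This
is Perron's characterization of exponential dichotomies, proved as follows.

Let [S_n] be the space of the [v] whose orbit from time [n] on is bounded, and
[U_n] the image of [Z] under [A_(n,0)].  Uniqueness for [y = 0] says that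
[S_n] and [U_n] meet only in 0, and that [A] is bijective between the [U_n].
To split a vector [v], force the equation by the orbit of [v] itself, divided
by [t_m - t_n], on a block of indices [n, ..., m] with
[1 <= t_m - t_n <= 2].  Past the block the solution coincides with the orbit
of [x_n + v], which is therefore in [S_n], whereas [x_n] is in [U_n]; the
forcing is controlled by the growth on a block, so [x_n] is controlled by [v]
uniformly in [n] ([splitting]).  Forcing by [y_n = weight * v] at a single
index would give a bound growing with the weight.

For the estimates, apply the bound on solutions to an orbit [u] multiplied by
a scalar which is affine in the time on [n, ..., m], constant outside, and
vanishes before [n] (if [u] is stable) or after [m] (if [u] starts in [Z]):
the forcing is then [u] on the block, up to sign ([ramp_bound]).  Over a block
of length between 1 and 2 this bounds the orbit by its initial (resp. final)
value; over a long block it then bounds it by that value divided by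
[t_m - t_n], hence by [1/e] times it when [t_m - t_n] is large.  Iterating
([clock_decay]) yields exponential decay. *)

(** * Real multiples in real or complex spaces *)

Section RealScalars.
Context (R : realType) (s : scalars).

Lemma of_realD (a b : R) : of_real s (a + b) = of_real s a + of_real s b.
Proof. by case: s => //=; rewrite rmorphD. Qed.

Lemma of_realM (a b : R) : of_real s (a * b) = of_real s a * of_real s b.
Proof. by case: s => //=; rewrite rmorphM. Qed.

Lemma of_real0 : of_real s (0 : R) = 0.
Proof. by case: s => //=; rewrite rmorph0. Qed.

Lemma of_real1 : of_real s (1 : R) = 1.
Proof. by case: s => //=; rewrite rmorph1. Qed.

Lemma modulus_of_real (a : R) : modulus (of_real s a) = `|a|.
Proof. by case: s => //=; rewrite expr0n /= addr0 sqrtr_sqr. Qed.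

Lemma modulusN1 : modulus (-1 : scalar_field R s) = 1.
Proof. by case: s; rewrite /modulus normrN1. Qed.

End RealScalars.

Section Norms.
Context (R : realType) (s : scalars) (X : lmodType (scalar_field R s)).
Context (f : X -> R).
Hypothesis f_norm : is_norm f.

Lemma is_norm_ge0 x : 0 <= f x.
Proof. by case: f_norm. Qed.

Lemma is_norm_eq0 x : f x = 0 -> x = 0.
Proof. by case: f_norm => _ + _ _; apply. Qed.

Lemma is_norm_scale r x : f (of_real s r *: x) = `|r| * f x.
Proof. by case: f_norm => _ _ -> _; rewrite modulus_of_real. Qed.

Lemma is_normD x y : f (x + y) <= f x + f y.
Proof. by case: f_norm. Qed.

Lemma is_norm0 : f 0 = 0.
Proof. by rewrite -(scale0r 0) -of_real0 is_norm_scale normr0 mul0r. Qed.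

Lemma is_normN x : f (- x) = f x.
Proof. by rewrite -scaleN1r; case: f_norm => _ _ -> _; rewrite modulusN1 mul1r. Qed.

End Norms.

(** * Products of the operators *)

Section Evolution.
Context (K : numFieldType) (X : lmodType K) (A : nat -> {linear X -> X}).

Lemma evol_id m n x : (m <= n)%N -> evol A m n x = x.
Proof. by case: m => // p pn /=; rewrite leqNgt pn. Qed.

Lemma evolS m n x : (n <= m)%N -> evol A m.+1 n x = A m (evol A m n x).
Proof. by move=> /= ->. Qed.

Lemma evol_comp m k n x : (n <= k)%N -> (k <= m)%N ->
  evol A m n x = evol A m k (evol A k n x).
Proof.
move=> nk; elim: m => [|m IH] km.
  by have -> : k = 0%N by lia.
move: km; rewrite leq_eqVlt => /orP[/eqP <-|km]; first by rewrite [RHS]evol_id.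
by rewrite !evolS ?IH//; lia.
Qed.

Lemma evol_linear m n a x y :
  evol A m n (a *: x + y) = a *: evol A m n x + evol A m n y.
Proof. by elim: m => //= m IH; case: ifP => // _; rewrite IH linearP. Qed.

Lemma evolD m n x y : evol A m n (x + y) = evol A m n x + evol A m n y.
Proof. by rewrite -[x]scale1r evol_linear !scale1r. Qed.

Lemma evol0 m n : evol A m n 0 = 0.
Proof.
have := evol_linear m n 1 0 0; rewrite !scale1r addr0 => /eqP.
by rewrite -subr_eq subrr => /eqP.
Qed.

Lemma evolZ m n a x : evol A m n (a *: x) = a *: evol A m n x.
Proof. by have := evol_linear m n a x 0; rewrite evol0 !addr0. Qed.

Lemma evolN m n x : evol A m n (- x) = - evol A m n x.
Proof. by rewrite -scaleN1r evolZ scaleN1r. Qed.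

Lemma evolB m n x y : evol A m n (x - y) = evol A m n x - evol A m n y.
Proof. by rewrite evolD evolN. Qed.

End Evolution.

(** * Exponential decay along a clock *)

Section Clock.
Context (R : realType) (t : nat -> R).
Hypothesis t_step : forall j, 0 <= t j.+1 - t j <= 1.
Hypothesis t_unbounded : forall b, exists m, b <= t m.

Lemma clock_le m n : (m <= n)%N -> t m <= t n.
Proof.
elim: n => [|n IH]; first by rewrite leqn0 => /eqP ->.
rewrite leq_eqVlt => /orP[/eqP -> //|/IH]; have := t_step n; lra.
Qed.

(** As the steps are at most 1, the first index at which the clock has advanced
by [l] overshoots by at most 1. *)
Lemma clock_block n (l : R) : 0 <= l ->
  exists2 m, (n <= m)%N & l <= t m - t n <= l + 1.
Proof.
move=> l0.
have ex : exists k, l <= t (n + k)%N - t n.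
  have [m tm] := t_unbounded (l + t n).
  exists m; have := @clock_le m (n + m)%N (leq_addl _ _); lra.
have [k lk min] := ex_minnP ex.
exists (n + k)%N; first exact: leq_addr.
case: k lk min => [|k] lk min; first by rewrite lk addn0 subrr /=; lra.
have : t (n + k)%N - t n < l.
  by rewrite ltNge; apply/negP => /min; rewrite ltnn.
have := t_step (n + k)%N; rewrite addnS in lk *; lra.
Qed.

(** If [t m - t n >= expR 1 * L + 1], then [fL] gives [f m <= f n / e].  Such
steps have length at most [expR 1 * L + 2], which is the rate in the
conclusion, and the last incomplete step costs the factor [K * expR 1]. *)
Lemma clock_decay (p : nat) (f : nat -> R) (K L : R) :
  0 <= K -> 0 <= L -> (forall m, 0 <= f m) ->
  (forall n m, (p <= n)%N -> (n <= m)%N -> f m <= K * f n) ->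
  (forall n m, (p <= n)%N -> (n <= m)%N -> (t m - t n) * f m <= L * f n) ->
  forall n m, (p <= n)%N -> (n <= m)%N ->
    f m <= K * expR 1 * expR (- ((expR 1 * L + 2)^-1 * (t m - t n))) * f n.
Proof.
move=> K0 L0 f0 fK fL n m pn nm.
set T := expR 1 * L + 2.
have e0 : 0 < expR 1 :> R by exact: expR_gt0.
have e1 : 1 <= expR 1 :> R by have := expR_ge1Dx (1 : R); lra.
have T0 : 0 < T by rewrite /T; have := mulr_ge0 (ltW e0) L0; lra.
(* Induction on the distance, moving [n] forward by one long block. *)
move: {2}(m - n)%N (leqnn (m - n)) => k.
elim: k n pn nm => [|k IH] n pn nm.
  rewrite leqn0 subn_eq0 => mn; have -> : m = n by lia.
  apply: le_trans (fK _ _ pn (leqnn n)) _; rewrite ler_wpM2r// -mulrA ler_peMr//.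
  by rewrite subrr mulr0 oppr0 expR0 mulr1.
move=> mk.
have T1 : 0 <= T - 1 by rewrite /T; have := mulr_ge0 (ltW e0) L0; lra.
have [j nj /andP[lj ju]] := clock_block n T1.
have [mj|jm] := leqP m j.
  apply: le_trans (fK _ _ pn nm) _; rewrite ler_wpM2r// -mulrA ler_peMr//.
  rewrite -expRD; apply: le_trans (expR_ge1Dx _).
  rewrite lerDl subr_ge0 mulrC ler_pdivrMr// mul1r.
  by have := clock_le mj; lra.
have nj' : (n < j)%N.
  rewrite ltn_neqAle nj andbT; apply/eqP => e; move: lj; rewrite e subrr.
  by rewrite /T; have := mulr_ge0 (ltW e0) L0; lra.
have fj : f j <= expR (-1) * f n.
  rewrite expRN mulrC ler_pdivlMr//.
  have := fL _ _ pn nj => h.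
  have h1 : (T - 1) * f j <= L * f n by apply: le_trans h; rewrite ler_wpM2r.
  have h2 : (T - 1) * (f j * expR 1) <= (T - 1) * f n.
    rewrite mulrA mulrC; apply: le_trans (ler_wpM2l (ltW e0) h1) _.
    by rewrite mulrA ler_wpM2r//; rewrite /T; lra.
  by move: h2; rewrite ler_pM2l//; rewrite /T; have := mulr_ge0 (ltW e0) L0; lra.
apply: le_trans (IH j _ _ _) _; [lia|lia|lia|].
apply: le_trans (ler_wpM2l _ fj) _.
  by rewrite !mulr_ge0// ?expR_ge0.
rewrite mulrA ler_wpM2r// -!mulrA ler_wpM2l// ler_wpM2l ?expR_ge0//.
rewrite -expRD ler_expR.
have -> : - (T^-1 * (t m - t n)) = - (T^-1 * (t m - t j)) - T^-1 * (t j - t n) by ring.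
rewrite lerB// mulrC ler_pdivrMr//; lra.
Qed.

End Clock.

(** * Stable and unstable spaces of an admissible equation *)

Section Admissibility.
Context (R : realType) (s : scalars) (X : lmodType (scalar_field R s)).
Context (A : nat -> {linear X -> X}) (N : nat -> X -> R) (Z : set X).
Context (t : nat -> R).

Definition bounded_seq (x : nat -> X) := exists B, forall j, N j (x j) <= B.

(** The term [y j] enters at the index [j.+1]; it is measured by [N j.+1]. *)
Definition forced_by (y x : nat -> X) :=
  forall j, x j.+1 = A j (x j) + of_real s (t j.+1 - t j) *: y j.

Definition admissible (C : R) :=
  (forall y B, (forall j, N j.+1 (y j) <= B) ->
     exists x, [/\ Z (x 0%N), bounded_seq x & forced_by y x]) /\
  (forall y x B, Z (x 0%N) -> bounded_seq x -> forced_by y x ->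
     (forall j, N j.+1 (y j) <= B) -> forall j, N j (x j) <= C * B).

Definition stable (n : nat) : set X :=
  [set v | exists B, forall m, (n <= m)%N -> N m (evol A m n v) <= B].

Definition unstable (n : nat) : set X := [set evol A n 0 z | z in Z].

Hypothesis N_norm : forall m, is_norm (N m).
Hypothesis Z_subspace : submod_closed [in Z].
Context (C : R).
Hypothesis adm : admissible C.

Lemma Z_scaleD a u v : Z u -> Z v -> Z (a *: u + v).
Proof.
move=> Zu Zv; have := Z_subspace.2 a u v.
by rewrite !inE; apply.
Qed.

Lemma Z_0 : Z 0.
Proof. by have := Z_subspace.1; rewrite inE. Qed.

Lemma Z_scale a u : Z u -> Z (a *: u).
Proof. by move=> Zu; rewrite -[_ *: _]addr0; apply: Z_scaleD Z_0. Qed.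

Lemma bounded_seq_finite (x : nat -> X) m :
  (forall j, (m <= j)%N -> x j = 0) -> bounded_seq x.
Proof.
move=> x0; exists (\sum_(i < m) N i (x i)) => j.
have [mj|jm] := leqP m j.
  by rewrite x0// is_norm0//; apply: sumr_ge0 => i _; apply: is_norm_ge0.
rewrite (bigD1 (Ordinal jm))//= lerDl.
by apply: sumr_ge0 => i _; apply: is_norm_ge0.
Qed.

(** A bounded orbit starting in [Z] solves the equation with zero forcing. *)
Lemma bounded_orbit_eq0 z : Z z -> stable 0 z -> z = 0.
Proof.
move=> Zz [B hB].
have /(_ 0%N) : forall j, N j (evol A j 0 z) <= C * 0.
  apply: (adm.2 (fun=> 0)) => //.
  - by exists B => j; apply: hB.
  - by move=> j /=; rewrite scaler0 addr0.
  - by move=> j; rewrite is_norm0.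
rewrite mulr0 /= => h; apply: (is_norm_eq0 (N_norm 0)).
by apply/eqP; rewrite eq_le h is_norm_ge0.
Qed.

(** Boundedness of an orbit does not depend on its finitely many first terms. *)
Lemma stable_evol n k v : (k <= n)%N -> stable n (evol A n k v) <-> stable k v.
Proof.
move=> kn; split=> [[B hB]|[B hB]]; last first.
  by exists B => m nm; rewrite -evol_comp//; apply: hB; lia.
exists (B + \sum_(i < n) N i (evol A i k v)) => m km.
have B0 : 0 <= B by apply: le_trans (is_norm_ge0 (N_norm n) _) (hB n (leqnn n)).
have s0 (P : pred 'I_n) : 0 <= \sum_(i < n | P i) N i (evol A i k v).
  by apply: sumr_ge0 => i _; apply: is_norm_ge0.
have [nm|mn] := leqP n m.
  rewrite (evol_comp _ _ kn nm); apply: le_trans (hB m nm) _.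
  by rewrite lerDl.
by rewrite (bigD1 (Ordinal mn))//= addrCA lerDl addr_ge0.
Qed.

Lemma stable_linear n a u v : stable n u -> stable n v -> stable n (a *: u + v).
Proof.
move=> [B hB] [B' hB']; exists (modulus a * B + B') => m nm.
rewrite evol_linear; apply: le_trans (is_normD (N_norm m) _ _) _.
apply: lerD; last exact: hB'.
case: (N_norm m) => N0 _ -> _; apply: ler_wpM2l; last exact: hB.
by case: s a => a /=; [|case: a => ? ? /=]; rewrite ?sqrtr_ge0.
Qed.

(** The difference [z' - z] has a bounded orbit, so that it vanishes.  This also
shows that [A_(n,0)] is injective on [Z], since 0 is stable. *)
Lemma stable_unstable_unique n v z z' : Z z -> Z z' ->
  stable n (v + evol A n 0 z) -> stable n (v + evol A n 0 z') -> z = z'.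
Proof.
move=> Zz Zz' h h'; apply/eqP; rewrite eq_sym -subr_eq0; apply/eqP.
apply: bounded_orbit_eq0; first by rewrite addrC -scaleN1r; apply: Z_scaleD.
apply/(stable_evol _ (leq0n n)).
have -> : evol A n 0 (z' - z) = -1 *: (v + evol A n 0 z) + (v + evol A n 0 z').
  by rewrite evolD evolN scaleN1r opprD addrACA addNr add0r addrC.
exact: stable_linear.
Qed.

Lemma splitting_unique n v w w' : stable n w -> unstable n (v - w) ->
  stable n w' -> unstable n (v - w') -> w = w'.
Proof.
move=> sw [z Zz ez] sw' [z' Zz' ez'].
have e1 : v + evol A n 0 (- z) = w by rewrite evolN ez opprB addrC subrK.
have e2 : v + evol A n 0 (- z') = w' by rewrite evolN ez' opprB addrC subrK.
rewrite -e1 -e2; congr (_ + evol _ _ _ _).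
apply: (@stable_unstable_unique n v); rewrite ?e1 ?e2//.
  by rewrite -scaleN1r; apply: Z_scale.
by rewrite -scaleN1r; apply: Z_scale.
Qed.

Lemma ker_unstable n (P : X -> X) :
  (forall v, stable n (P v)) -> (forall v, unstable n (v - P v)) ->
  ker P = unstable n.
Proof.
move=> sP uP; apply/seteqP; split=> v /=.
  by move=> Pv; have := uP v; rewrite Pv subr0.
move=> uv; apply: (@splitting_unique n v) => //.
  by exists 0 => m _; rewrite evol0 is_norm0.
by rewrite subr0.
Qed.

(** The case [v = - A_(n,0) z] of the uniqueness of [z] gives injectivity. *)
Lemma unstable_bij m n : (m <= n)%N ->
  set_bij (unstable m) (unstable n) (evol A n m).
Proof.
move=> mn; split.
- by move=> _ [z Zz <-]; exists z => //; rewrite -evol_comp.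
- move=> u v; rewrite !inE => -[z Zz <-] [z' Zz' <-].
  rewrite -!evol_comp// => e; congr (evol _ _ _ _).
  apply: (@stable_unstable_unique n (- evol A n 0 z)) => //.
    by rewrite addNr; exists 0 => j _; rewrite evol0 is_norm0.
  by rewrite e addNr; exists 0 => j _; rewrite evol0 is_norm0.
- by move=> _ [z Zz <-]; exists (evol A m 0 z); [exists z|rewrite -evol_comp].
Qed.

(** * Uniform bounds from admissibility *)

Hypothesis t_step : forall j, 0 <= t j.+1 - t j <= 1.
Hypothesis t_unbounded : forall b, exists m, b <= t m.
Hypothesis C_ge0 : 0 <= C.
Context (G : R).
Hypothesis G_ge0 : 0 <= G.
Hypothesis growth : forall m n x, (n <= m)%N -> t m - t n <= 2 ->
  N m (evol A m n x) <= G * N n x.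

(** [t (clamp n m j)] is the clock stopped outside the block from [n] to [m]. *)
Definition clamp (n m j : nat) := maxn n (minn j m).

Lemma clamp_step n m j : (n <= m)%N ->
  t (clamp n m j.+1) - t (clamp n m j) =
  if (n <= j < m)%N then t j.+1 - t j else 0.
Proof.
move=> nm; case: ifP => [/andP[nj jm]|/negbT h].
  by congr (t _ - t _); rewrite /clamp; lia.
have -> : clamp n m j.+1 = clamp n m j by rewrite /clamp; lia.
by rewrite subrr.
Qed.

(** The scaled sequence [(t (clamp n m j) - e) u_j] solves the equation forced by
[u] on the block and by 0 elsewhere.  The choice [e = t n] makes it vanish
before the block, where [u] may fail to be an orbit; the choice [e = t m]
makes it vanish after the block, where the orbit [u] may be unbounded. *)
Lemma ramp_bound (u : nat -> X) n m (e B : R) : (n <= m)%N -> 0 <= B ->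
  (forall j, t (clamp n m j) = e \/ u j.+1 = A j (u j)) ->
  bounded_seq (fun j => of_real s (t (clamp n m j) - e) *: u j) ->
  Z (of_real s (t (clamp n m 0) - e) *: u 0%N) ->
  (forall j, (n < j <= m)%N -> N j (u j) <= B) ->
  forall j, `|t (clamp n m j) - e| * N j (u j) <= C * B.
Proof.
move=> nm B0 hu bnd Z0 uB j; rewrite -is_norm_scale//.
pose y j := if (n <= j < m)%N then u j.+1 else 0.
apply: (adm.2 y (fun j => of_real s (t (clamp n m j) - e) *: u j)) => //.
  move=> i; rewrite linearZ /=.
  have -> : of_real s (t i.+1 - t i) *: y i =
      of_real s (t (clamp n m i.+1) - t (clamp n m i)) *: u i.+1.
    rewrite clamp_step// /y; case: ifP => // _.
    by rewrite scaler0 of_real0 scale0r.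
  have -> : of_real s (t (clamp n m i) - e) *: A i (u i)
      = of_real s (t (clamp n m i) - e) *: u i.+1.
    by case: (hu i) => [->|-> //]; rewrite subrr of_real0 !scale0r.
  by rewrite -scalerDl -of_realD; congr (of_real s _ *: _); ring.
move=> i; rewrite /y; case: ifP => h; last by rewrite is_norm0.
by apply: uB; lia.
Qed.

(** The solution forced by the orbit of [v] on a block, normalized by the length
[S] of the block, adds to the orbit of its initial value the orbit of [v] with
a coefficient rising from 0 at [n] to 1 at the end of the block. *)
Lemma splitting n v :
  exists z, [/\ Z z, stable n (v + evol A n 0 z) &
               N n (evol A n 0 z) <= C * G * N n v].
Proof.
have [m nm /andP[s1 s2]] := clock_block t_step t_unbounded n (l := 1) ler01.
set S := t m - t n in s1 s2.
have S0 : 0 < S by lra.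
pose u j := evol A j n v.
pose y j := if (n <= j < m)%N then of_real s S^-1 *: u j.+1 else 0.
have yB j : N j.+1 (y j) <= G * N n v.
  rewrite /y; case: ifP => h; last first.
    by rewrite is_norm0// mulr_ge0// is_norm_ge0.
  rewrite is_norm_scale// ger0_norm ?invr_ge0 ?(ltW S0)//.
  have g : N j.+1 (u j.+1) <= G * N n v.
    apply: growth; first lia.
    have jm : (j.+1 <= m)%N by lia.
    by have := clock_le t_step jm; move: s2; rewrite /S; lra.
  apply: le_trans g; rewrite mulrC ler_pdivrMr// ler_peMr// is_norm_ge0//.
have [x [Zx [B hB] fx]] := adm.1 y _ yB.
have xc j : x j = evol A j 0 (x 0%N)
    + of_real s (S^-1 * (t (clamp n m j) - t n)) *: u j.
  elim: j => [|j IH].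
    have -> : clamp n m 0 = n by rewrite /clamp; lia.
    by rewrite subrr mulr0 of_real0 scale0r addr0 evol_id.
  rewrite fx {1}IH linearD linearZ /= -addrA; congr (_ + _).
  have -> : t (clamp n m j.+1) = t (clamp n m j) +
      (t (clamp n m j.+1) - t (clamp n m j)) by ring.
  rewrite clamp_step// /y.
  have [nj|jn] := leqP n j; last first.
    have -> : clamp n m j = n by rewrite /clamp; lia.
    by rewrite /= addr0 subrr mulr0 of_real0 !scale0r scaler0 addr0.
  have -> : A j (u j) = u j.+1 by rewrite /u evolS.
  case: ifP => _; last by rewrite scaler0 !addr0.
  by rewrite scalerA -scalerDl -of_realM -of_realD; congr (of_real s _ *: _); ring.
have xn : x n = evol A n 0 (x 0%N).
  rewrite xc; have -> : clamp n m n = n by rewrite /clamp; lia.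
  by rewrite subrr mulr0 of_real0 scale0r addr0.
exists (x 0%N); split => //.
  apply/(stable_evol _ nm); exists B => j mj.
  rewrite -evol_comp// evolD addrC -evol_comp//; last lia.
  suff -> : evol A j 0 (x 0%N) + evol A j n v = x j by [].
  rewrite [RHS]xc; have -> : clamp n m j = m by rewrite /clamp; lia.
  by rewrite -/S mulVf ?gt_eqF// of_real1 scale1r.
by rewrite -xn -mulrA; apply: (adm.2 y) yB _ => //; exists B.
Qed.

(* [G] bounds the growth within a block, and [C * G] what the ramp gives beyond
   it; their sum serves for both. *)
Let K := (C + 1) * G.

(** The ramp on the block from [p] to [q] which vanishes before [p] is bounded
since the orbit is; it bounds the orbit from [q] on by its values on the block. *)
Lemma stable_decay n v : stable n v ->
  forall m, (n <= m)%N ->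
  N m (evol A m n v) <=
    K * expR 1 * expR (- ((expR 1 * (C * K) + 2)^-1 * (t m - t n))) * N n v.
Proof.
move=> [B0 hB0] m nm.
pose f j := N j (evol A j n v).
have f0 j : 0 <= f j by apply: is_norm_ge0.
have K0 : 0 <= K by rewrite /K mulr_ge0// addr_ge0.
have CK0 : 0 <= C * K by rewrite mulr_ge0.
have BB0 : 0 <= B0 by apply: le_trans (f0 n) (hB0 n (leqnn n)).
have ramp p q i B : (n <= p)%N -> (p <= q)%N -> (q <= i)%N -> 0 <= B ->
    (forall j, (p < j <= q)%N -> f j <= B) -> (t q - t p) * f i <= C * B.
  move=> np pq qi Bge0 fB.
  have cl : clamp p q i = q by rewrite /clamp; lia.
  have tq : 0 <= t q - t p by rewrite subr_ge0 clock_le.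
  rewrite -(ger0_norm tq) -{1}cl.
  apply: (ramp_bound (u := fun j => evol A j n v)) => //.
  - move=> j; have [pj|jp] := leqP p j; first by right; rewrite evolS//; lia.
    by left; congr t; rewrite /clamp; lia.
  - exists ((t q - t p) * B0) => j; rewrite is_norm_scale//.
    have [nj|jn] := leqP n j; last first.
      have -> : clamp p q j = p by rewrite /clamp; lia.
      by rewrite subrr normr0 mul0r mulr_ge0.
    apply: ler_pM => //; [exact: f0| |exact: hB0].
    have h1 : t p <= t (clamp p q j) by rewrite clock_le// /clamp; lia.
    have h2 : t (clamp p q j) <= t q by rewrite clock_le// /clamp; lia.
    by rewrite ger0_norm; lra.
  - have -> : clamp p q 0 = p by rewrite /clamp; lia.
    by rewrite subrr of_real0 scale0r; apply: Z_0.
have fG p q : (n <= p)%N -> (p <= q)%N -> t q - t p <= 2 -> f q <= G * f p.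
  by move=> np pq h; rewrite /f (evol_comp _ _ np pq); apply: growth.
have fK p q : (n <= p)%N -> (p <= q)%N -> f q <= K * f p.
  move=> np pq.
  (* A block following [p] bounds [f q] if [q] is beyond it, growth if not. *)
  have [r pr /andP[r1 r2]] := clock_block t_step t_unbounded p (l := 1) ler01.
  have Gf : 0 <= G * f p by rewrite mulr_ge0.
  have CGf : 0 <= C * (G * f p) by rewrite mulr_ge0.
  have eK : K * f p = C * (G * f p) + G * f p by rewrite /K; ring.
  have [rq|qr] := leqP r q; last first.
    have tqr := clock_le t_step (ltnW qr).
    rewrite eK; apply: le_trans (fG p q np pq _) _; lra.
  have := ramp p r q (G * f p) np pr rq Gf.
  have fB j : (p < j <= r)%N -> f j <= G * f p.
    move=> /andP[pj jr]; apply: fG => //; first exact: ltnW.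
    by have := clock_le t_step jr; lra.
  move=> /(_ fB) h; apply: (@le_trans _ _ ((t r - t p) * f q)).
    by rewrite ler_peMl//; lra.
  by rewrite eK; lra.
have fL p q : (n <= p)%N -> (p <= q)%N -> (t q - t p) * f q <= C * K * f p.
  move=> np pq; rewrite -mulrA; apply: ramp => //; first by rewrite mulr_ge0.
  by move=> j /andP[pj _]; apply: fK => //; exact: ltnW.
have := @clock_decay _ _ t_step t_unbounded n f K (C * K) K0 CK0 f0 fK fL.
by move=> /(_ n m (leqnn n) nm); rewrite /f [evol A n n v]evol_id.
Qed.

(** Here the decay is backward in time.  The ramp on the block from [p] to [q]
which vanishes after [q] bounds the orbit up to [p] by its values on the block;
a block following the final index turns growth into a backward bound.  A
nonzero orbit starting in [Z] never vanishes, so the inverses of its norms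
decay forward and [clock_decay] applies to them. *)
Lemma unstable_decay n m z : Z z -> (n <= m)%N ->
  N n (evol A n 0 z) <=
    K * expR 1 * expR (- ((expR 1 * (C * K) + 2)^-1 * (t m - t n)))
      * N m (evol A m 0 z).
Proof.
move=> Zz nm.
pose f j := N j (evol A j 0 z).
have f0 j : 0 <= f j by apply: is_norm_ge0.
have K0 : 0 <= K by rewrite /K mulr_ge0// addr_ge0.
have CK0 : 0 <= C * K by rewrite mulr_ge0.
have ramp i p q B : (i <= p)%N -> (p <= q)%N -> 0 <= B ->
    (forall j, (p < j <= q)%N -> f j <= B) -> (t q - t p) * f i <= C * B.
  move=> ip pq Bge0 fB.
  have cl : clamp p q i = p by rewrite /clamp; lia.
  have tq : 0 <= t q - t p by rewrite subr_ge0 clock_le.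
  rewrite -(ger0_norm tq) distrC -{1}cl.
  apply: (ramp_bound (u := fun j => evol A j 0 z)) => //.
  - by move=> j; right; rewrite evolS.
  - apply: (bounded_seq_finite (m := q)) => j qj.
    have -> : clamp p q j = q by rewrite /clamp; lia.
    by rewrite subrr of_real0 scale0r.
  - exact: Z_scale.
have fG p q : (p <= q)%N -> t q - t p <= 2 -> f q <= G * f p.
  by move=> pq h; rewrite /f (evol_comp _ _ (leq0n p) pq); apply: growth.
have fK p q : (p <= q)%N -> f p <= K * f q.
  move=> pq.
  have [r qr /andP[r1 r2]] := clock_block t_step t_unbounded q (l := 1) ler01.
  have Gf : 0 <= G * f q by rewrite mulr_ge0.
  have fB j : (q < j <= r)%N -> f j <= G * f q.
    move=> /andP[qj jr]; apply: fG => //; first exact: ltnW.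
    by have := clock_le t_step jr; lra.
  have h := ramp p q r (G * f q) pq qr Gf fB.
  apply: (@le_trans _ _ ((t r - t q) * f p)).
    by rewrite ler_peMl//; lra.
  have -> : K * f q = C * (G * f q) + G * f q by rewrite /K; ring.
  by lra.
have fL p q : (p <= q)%N -> (t q - t p) * f p <= C * K * f q.
  move=> pq; rewrite -mulrA; apply: ramp => //; first by rewrite mulr_ge0.
  by move=> j /andP[_ jq]; apply: fK.
have [z0|z0] := eqVneq z 0.
  by rewrite z0 !evol0 !is_norm0// mulr0.
have f1 j : 0 < f j.
  rewrite lt_neqAle f0 andbT eq_sym; apply: contra z0 => /eqP fj0.
  apply/eqP/bounded_orbit_eq0 => //.
  apply/(stable_evol _ (leq0n j)); exists 0 => m' jm.
  by rewrite (is_norm_eq0 (N_norm j) fj0) evol0 is_norm0.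
have := @clock_decay _ _ t_step t_unbounded 0 (fun j => (f j)^-1) K (C * K) K0 CK0.
have h1 j : 0 <= (f j)^-1 by rewrite invr_ge0.
move=> /(_ h1 _ _ n m (leq0n n) nm) h.
rewrite -/(f n) -/(f m) -ler_pdivrMr// mulrC -ler_pdivlMr//; apply: h.
  by move=> p q _ pq; rewrite ler_pdivlMr// mulrC ler_pdivrMr// fK.
by move=> p q _ pq; rewrite ler_pdivlMr// mulrAC ler_pdivrMr// fL.
Qed.

(** The vector of [Z] given by [splitting] is unique, so it depends linearly on
the vector that is split. *)
Lemma splitting_projections : exists P : nat -> {linear X -> X},
  [/\ forall n v, stable n (P n v),
      forall n v, unstable n (v - P n v)
    & forall n v, N n (v - P n v) <= C * G * N n v].
Proof.
suff ex n : exists Pn : {linear X -> X}, forall v,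
    [/\ stable n (Pn v), unstable n (v - Pn v) & N n (v - Pn v) <= C * G * N n v].
  have [P hP] := choice ex.
  by exists P; split=> n v; case: (hP n v).
have [z hz] := choice (splitting n).
pose f v := v + evol A n 0 (z v).
have f_lin : linear f.
  move=> a u v; rewrite /f; set w := a *: u + v.
  suff -> : z w = a *: z u + z v by rewrite evol_linear scalerDr addrACA.
  have [Zu su _] := hz u; have [Zv sv _] := hz v; have [Zw sw _] := hz w.
  apply: (stable_unstable_unique Zw _ sw); first exact: Z_scaleD.
  by rewrite evol_linear addrACA -scalerDr; apply: stable_linear.
pose F : {linear X -> X} := HB.pack f (GRing.isLinear.Build _ _ _ _ f f_lin).
exists F => v; have [Zz sz bz] := hz v.
have -> : v - F v = - evol A n 0 (z v) by rewrite /= /f opprD addrA subrr add0r.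
split; [exact: sz| |by rewrite is_normN].
by exists (- z v); [rewrite -scaleN1r; apply: Z_scale|rewrite evolN].
Qed.

End Admissibility.

(** * The logarithmic clock *)

Section LogClock.
Context (R : realType).

Definition log_clock (m : nat) : R := \sum_(j < m) (weight R j.+2)^-1.

Lemma log_clockS m : log_clock m.+1 - log_clock m = (weight R m.+2)^-1.
Proof. by rewrite /log_clock big_ord_recr /= addrAC subrr add0r. Qed.

Lemma nu_gt0 m : 0 < nu R m.+1.
Proof. by rewrite /nu ln_gt0// ltr1n. Qed.

(** This is [m + 3 <= (m + 2) ^ 2]; it makes the steps of the clock at most 1. *)
Lemma nuS_le m : nu R m.+2 <= 2 * nu R m.+1.
Proof.
rewrite mulrC mulr_natr -lnXn ?ltr0n// ler_ln ?posrE ?exprn_gt0 ?ltr0n//.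
by rewrite -natrX ler_nat; nia.
Qed.

Lemma nu_le m : nu R m.+1 <= nu R m.+2.
Proof. by rewrite ler_ln ?posrE ?ltr0n// ler_nat. Qed.

Lemma log_clock_nu m : log_clock m.+1 - log_clock m = nu R m.+3 / nu R m.+2 - 1.
Proof.
rewrite log_clockS /weight invf_div.
have -> : 1 + m.+3%:R^-1 = m.+4%:R / m.+3%:R :> R.
  by rewrite -[m.+4]addn1 natrD mulrDl divff// mul1r.
rewrite ln_div ?posrE ?ltr0n// -/(nu R m.+2) -/(nu R m.+3) mulrBl divff//.
by rewrite gt_eqF// nu_gt0.
Qed.

Lemma log_clock_step m : 0 <= log_clock m.+1 - log_clock m <= 1.
Proof.
rewrite log_clock_nu subr_ge0 lerBlDr ler_pdivrMr ?nu_gt0// ler_pdivlMr ?nu_gt0//.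
by rewrite mul1r nu_le nuS_le.
Qed.

(** Each ratio of consecutive terms is [1 + (t_(m+1) - t_m)], which is at most
the exponential of the step. *)
Lemma nu_ratio_le_expR m n : (n <= m)%N ->
  nu R m.+2 / nu R n.+2 <= expR (log_clock m - log_clock n).
Proof.
elim: m => [|m IH].
  by rewrite leqn0 => /eqP ->; rewrite divff ?gt_eqF ?nu_gt0// subrr expR0.
rewrite leq_eqVlt => /orP[/eqP ->|nm].
  by rewrite divff ?gt_eqF ?nu_gt0// subrr expR0.
have -> : log_clock m.+1 - log_clock n =
  (log_clock m.+1 - log_clock m) + (log_clock m - log_clock n) by ring.
have -> : nu R m.+3 / nu R n.+2 = (nu R m.+3 / nu R m.+2) * (nu R m.+2 / nu R n.+2).
  by rewrite mulrA divfK// gt_eqF// nu_gt0.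
rewrite expRD ler_pM ?IH//; try by rewrite divr_ge0// ltW// nu_gt0.
by apply: le_trans (expR_ge1Dx _); rewrite log_clock_nu addrC subrK.
Qed.

(** The exponential of the clock dominates [nu], which is unbounded. *)
Lemma log_clock_unbounded b : exists m, b <= log_clock m.
Proof.
have [k Ek] : exists k, expR (nu R 2 * expR b) < k.+1%:R.
  by exists (Num.truncn (expR (nu R 2 * expR b))); exact: truncnS_gt.
exists k; have := nu_ratio_le_expR (leq0n k).
rewrite /log_clock big_ord0 subr0 => h; rewrite -ler_expR; apply: le_trans h.
rewrite ler_pdivlMr ?nu_gt0// mulrC -[leLHS]expRK ler_ln ?posrE ?expR_gt0 ?ltr0n//.
by apply: ltW; apply: lt_le_trans Ek _; rewrite ler_nat; lia.
Qed.

(** The clock compares [nu m.+2] and [nu n.+2], one index beyond the terms of the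
dichotomy; the shift costs a factor 2 by [nuS_le]. *)
Lemma expR_log_clock_le (a : R) m n : 0 <= a -> (n <= m)%N ->
  expR (- (a * (log_clock m - log_clock n)))
    <= 2 `^ a * (nu R m.+1 / nu R n.+1) `^ (- a).
Proof.
move=> a0 nm.
have r0 : 0 < nu R m.+1 / nu R n.+1 by rewrite divr_gt0 ?nu_gt0.
rewrite expRN powRN ler_pdivlMr ?powR_gt0// mulrC ler_pdivrMr ?expR_gt0//.
rewrite [a * _]mulrC expRM -powRM ?expR_ge0//.
apply: ge0_ler_powR => //; rewrite ?nnegrE; [exact: ltW| |].
  by rewrite mulr_ge0// expR_ge0.
have h := nu_ratio_le_expR nm; rewrite ler_pdivrMr ?nu_gt0// in h.
rewrite ler_pdivrMr ?nu_gt0//.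
apply: le_trans (nu_le m) _; apply: le_trans h _.
by rewrite -mulrA mulrCA ler_wpM2l ?expR_ge0// nuS_le.
Qed.

End LogClock.

(** The equation [T x = y] reads [x_(j+1) = A_j x_j + y_(j+1) / weight], so
surjectivity gives solutions, and injectivity identifies a given solution with
the value of the inverse, whose norm is controlled. *)
Lemma T_nu_admissible (R : realType) (s : scalars)
    (X : lmodType (scalar_field R s)) (A : nat -> {linear X -> X})
    (N : nat -> X -> R) (Z : set X) :
  (forall m, is_norm (N m)) -> T_nu_invertible A N Z ->
  exists2 C : R, 0 <= C & admissible A N Z (log_clock R) C.
Proof.
move=> N_norm [[Tfun Tinj Tsurj] [C hC]].
have w0 m : weight R m.+2 != 0.
  rewrite -invr_eq0 -log_clockS log_clock_nu.
  rewrite subr_eq0 gt_eqF// ltr_pdivlMr ?nu_gt0// mul1r.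
  by rewrite ltr_ln ?posrE ?ltr0n// ltr_nat.
have nonneg_bound x B : (forall j, N j (x j) <= B) -> 0 <= B.
  by move=> /(_ 0%N); apply: le_trans; apply: is_norm_ge0.
have ub x B : (forall j, N j (x j) <= B) -> has_ubound (range (fun m => N m (x m))).
  by move=> h; exists B => _ [j _ <-].
exists `|C|; first exact: normr_ge0.
split=> [y B yB|y x B Zx [B' xB'] fx yB j].
  pose y' j := if j is k.+1 then y k else 0.
  have Yy' : Y_ N [set 0] y'.
    split => //; apply: (ub _ B) => -[|j] //=.
    by rewrite is_norm0//; apply: le_trans (yB 0%N); apply: is_norm_ge0.
  have [x [[xub Zx] _] Tx] := Tsurj _ Yy'.
  exists x; split => //.
    by have [B' hB'] := xub; exists B' => j; apply: hB'; exists j.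
  move=> j; have /= <- := congr1 (@^~ j.+1) Tx.
  by rewrite log_clockS scalerA -of_realM mulVf// of_real1 scale1r addrC subrK.
have Tx k : T_nu A x k.+1 = y k.
  rewrite /T_nu fx addrAC subrr add0r log_clockS scalerA -of_realM divff//.
  by rewrite of_real1 scale1r.
have B0 : 0 <= B by apply: le_trans (yB 0%N); apply: is_norm_ge0.
have TxB k : N k (T_nu A x k) <= B.
  by case: k => [|k]; [rewrite /= is_norm0|rewrite Tx].
have YTx : Y_ N [set 0] (T_nu A x) by split => //; apply: ub TxB.
have domx : T_dom A N Z x by split => //; split => //; apply: ub xB'.
have := hC _ YTx; rewrite pinvKV ?inE// => h.
have sup_le : supnorm N (T_nu A x) <= B.
  by apply: ge_sup; [exists (N 0%N (T_nu A x 0%N)); exists 0%N|move=> _ [k _ <-]].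
have le_supnorm z k B1 : (forall i, N i (z i) <= B1) -> N k (z k) <= supnorm N z.
  by move=> hz; apply: ub_le_sup; [apply: ub hz|exists k].
have sup0 : 0 <= supnorm N (T_nu A x).
  exact: le_trans (is_norm_ge0 (N_norm 0%N) _) (le_supnorm _ 0%N _ TxB).
apply: le_trans (le_supnorm x j _ xB') _.
apply: (@le_trans _ _ (graph_norm A N x)); first by rewrite lerDl.
apply: le_trans h _; apply: (@le_trans _ _ (`|C| * supnorm N (T_nu A x))).
  by rewrite ler_wpM2r// ler_norm.
by rewrite ler_wpM2l.
Qed.

(** * The logarithmic dichotomy *)

Theorem corollary6p12 (R : realType) (s : scalars)
    (X : completeNormedModType (scalar_field R s))
    (A : nat -> {linear X -> X}) (N : nat -> X -> R) (Z : set X)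
    (A_bounded : forall m, bounded_operator (A m))
    (N_norm : forall m, is_norm (N m))
    (N_equiv : forall m, equivalent_norms (N m) (@vnorm R s X))
    (Z_subspace : submod_closed [in Z]) (Z_closed : closed Z)
    (T_inv : T_nu_invertible A N Z)
    (growth : exists lambda M : R, [/\ 0 < lambda, 0 < M &
       forall m n x, (n <= m)%N ->
         N m (evol A m n x)
         <= M * (ln (m.+1 + 2)%:R / ln (n.+1 + 2)%:R) `^ lambda * N n x]) :
  nonuniform_log_dichotomy A N.
Proof.
have [lambda [M [lambda0 M0 growthM]]] := growth.
have [C C0 adm] := T_nu_admissible N_norm T_inv.
pose t := log_clock R.
have t_step : forall j, 0 <= t j.+1 - t j <= 1 := @log_clock_step R.
have t_unbounded : forall b, exists m, b <= t m := @log_clock_unbounded R.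
pose G := M * expR (2 * lambda).
have G0 : 0 <= G by rewrite mulr_ge0// ?expR_ge0// ltW.
have growthG m n x : (n <= m)%N -> t m - t n <= 2 ->
    N m (evol A m n x) <= G * N n x.
  move=> nm tmn; apply: le_trans (growthM m n x nm) _.
  rewrite ler_wpM2r ?is_norm_ge0// ler_wpM2l ?(ltW M0)// expRM !addn2.
  apply: ge0_ler_powR; rewrite ?nnegrE ?(ltW lambda0) ?expR_ge0//.
    by rewrite divr_ge0 ?ltW ?(nu_gt0 R _.+1).
  by apply: le_trans (nu_ratio_le_expR R nm) _; rewrite ler_expR.
have [P [sP uP QP]] :=
  splitting_projections N_norm Z_subspace adm t_step t_unbounded C0 G0 growthG.
have unique := splitting_unique N_norm Z_subspace adm.
have kerE n : ker (P n) = unstable A Z n.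
  exact: (ker_unstable N_norm Z_subspace adm (sP n) (uP n)).
have bij m n : (m <= n)%N -> set_bij (ker (P m)) (ker (P n)) (evol A n m).
  by rewrite !kerE; apply: (unstable_bij N_norm Z_subspace adm).
pose K := (C + 1) * G * expR 1.
pose a := (expR 1 * (C * ((C + 1) * G)) + 2)^-1.
have CG0 : 0 <= C * G by rewrite mulr_ge0.
have C10 : 0 <= C + 1 by rewrite addr_ge0.
have K0 : 0 <= K by apply: mulr_ge0; [exact: mulr_ge0|exact: expR_ge0].
have a0 : 0 < a.
  by rewrite invr_gt0 ltr_wpDl //; do !(apply: mulr_ge0 => //).
pose D := (K * (1 + C * G) + 1) * 2 `^ a.
have CG1 : 0 <= 1 + C * G by rewrite addr_ge0.
have D0 : 0 < D by rewrite mulr_gt0 ?powR_gt0// ltr_wpDl// mulr_ge0.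
(* Both estimates reach the form of the dichotomy in the same way: [c] is the
   norm of a component of a vector of norm [x]. *)
have to_D n m x c : (n <= m)%N -> 0 <= c -> c <= (1 + C * G) * x -> 0 <= x ->
    K * expR (- (a * (t m - t n))) * c
      <= D * (nu R m.+1 / nu R n.+1) `^ (- a) * x.
  move=> nm c0 cx x0.
  have := expR_log_clock_le (ltW a0) nm; rewrite -/t.
  set E := expR _; set r := _ `^ (- a) => Er.
  have E0 : 0 <= E by apply: expR_ge0.
  apply: (@le_trans _ _ (K * E * ((1 + C * G) * x))).
    by rewrite ler_wpM2l// mulr_ge0.
  have -> : K * E * ((1 + C * G) * x) = (K * (1 + C * G)) * E * x by ring.
  rewrite ler_wpM2r// /D -[leRHS]mulrA.
  by apply: ler_pM => //; [exact: mulr_ge0|rewrite lerDl].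
have Q_le n x : N n (x - P n x) <= (1 + C * G) * N n x.
  by apply: le_trans (QP n x) _; rewrite ler_wpM2r ?is_norm_ge0// lerDr.
have P_le n x : N n (P n x) <= (1 + C * G) * N n x.
  have -> : P n x = x - (x - P n x) by rewrite opprB addrC subrK.
  apply: le_trans (is_normD (N_norm n) _ _) _.
  by rewrite is_normN// mulrDl mul1r lerD2l.
have pinv_le m n y : (m <= n)%N -> ker (P n) y ->
    N m ('pinv_(fun=> 0) (ker (P m)) (evol A n m) y)
      <= K * expR (- (a * (t n - t m))) * N n y.
  move=> mn ky; have [_ inj surj] := bij m n mn.
  have [u ku uy] := surj _ ky.
  rewrite -uy pinvKV ?inE//.
  move: ku; rewrite kerE => -[z Zz <-]; rewrite -(evol_comp _ _ (leq0n m) mn).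
  exact: (unstable_decay N_norm Z_subspace adm t_step t_unbounded C0 G0 growthG).
exists P; split.
- move=> m x; apply/esym; apply: (unique m (P m x)) => //.
  by rewrite subrr -(evol0 A m 0); exists 0 => //; apply: Z_0.
- move=> m; have Ebij := bij _ _ (leqnSn m).
  have evA : evol A m.+1 m = A m.
    by apply/funext => x; rewrite evolS// evol_id.
  split; first by rewrite -evA.
  (* Over one step the backward estimate bounds the inverse; the norms of the
     indices m and m+1 are then compared with the norm of X. *)
  have [c [c1 [c0 _ hc]]] := N_equiv m.
  have [c'1 [c' [_ c'0 hc']]] := N_equiv m.+1.
  pose B := K * expR (- (a * (t m.+1 - t m))).
  exists (c^-1 * (B * c')) => y ky.
  have h := pinv_le _ _ _ (leqnSn m) ky; rewrite evA -/B in h.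
  rewrite -mulrA mulrC ler_pdivlMr// mulrC.
  have [h1 _] := andP (hc ('pinv_(fun=> 0) (ker (P m)) (A m) y)).
  have [_ h2] := andP (hc' y).
  apply: le_trans h1 _; apply: le_trans h _.
  by rewrite -mulrA ler_wpM2l// mulr_ge0// expR_ge0.
- move=> m n x nm; apply: (unique m (evol A m n x)) => //.
    by apply/(stable_evol A N_norm (P n x) nm).
  have [homo _ _] := bij n m nm.
  by rewrite -evolB -kerE; apply: homo; rewrite kerE.
exists a, D; split=> // [m n x nm|m n x mn].
  have := stable_decay N_norm Z_subspace adm t_step t_unbounded C0 G0 growthG.
  move=> /(_ n _ (sP n x) m nm) h; apply: le_trans h _.
  by apply: to_D => //; rewrite is_norm_ge0.
apply: le_trans (pinv_le m n _ mn _) _; last by apply: to_D => //; rewrite is_norm_ge0.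
by rewrite kerE.
Qed.
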